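(* Let $r\ge2$ and let $\rho_1,\ldots,\rho_r$ be quantum states on a $d$-dimensional Hilbert space. Then the multivariate SDP fidelity equals the $K^\star$-representation: $$F_{\mathrm{SDP}}(\rho_1,\ldots,\rho_r)=F_{K^\star}(\rho_1,\ldots,\rho_r).$$
   Context: A quantum state is a positive semi-definite operator of unit trace on a finite-dimensional complex Hilbert space. $\{|i\rangle\}_{i=1}^r$ is the standard basis of $\mathbb C^r$; $\ge$ is the Loewner order; $I_m$ is the identity on an $m$-dimensional space. Multivariate SDP fidelity: $$F_{\mathrm{SDP}}(\rho_1,\ldots,\rho_r)=\frac{1}{r(r-1)}\inf_{Y_1,\ldots,Y_r\ge0}\Big\{\sum_{i=1}^r\operatorname{Tr}[Y_i\rho_i]:\ \sum_{i=1}^r|i\rangle\langle i|\otimes Y_i\ \ge\ \sum_{i\ne j}|i\rangle\langle j|\otimes I_d\Big\}.$$ $K^\star$-representation: for each $i$ let $|\phi^{\rho_i}\rangle\in\mathcal H_R\otimes\mathcal H_A$ be a (arbitrary) purification of $\rho_i$, where $\dim\mathcal H_R=\dim\mathcal H_A=d$, i.e. a unit vector with $\operatorname{Tr}_R|\phi^{\rho_i}\rangle\langle\phi^{\rho_i}|=\rho_i$. Put $|\psi\rangle=\frac1{\sqrt r}\sum_{i=1}^r|i\rangle|\phi^{\rho_i}\rangle\in\mathbb C^r\otimes\mathcal H_R\otimes\mathcal H_A$. Then $$F_{K^\star}(\rho_1,\ldots,\rho_r)=\frac{1}{r-1}\sup_{K\ge0}\Big\{\langle\psi|K\otimes I_d|\psi\rangle-1:\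 K=I_r\otimes I_d+\sum_{i\neq j}|i\rangle\langle j|\otimes K_{ij}\Big\},$$ where $K$ acts on $\mathbb C^r\otimes\mathcal H_R$ (the $K_{ij}$ being operators on the purifying system $\mathcal H_R$) and the $I_d$ in $K\otimes I_d$ acts on $\mathcal H_A$. *)

(* Defs.v *)
From mathcomp Require Import all_boot all_order all_algebra.
From mathcomp Require Import spectral mxtens complex.
From mathcomp Require Import classical_sets reals constructive_ereal ereal.

Set Implicit Arguments.
Unset Strict Implicit.
Unset Printing Implicit Defensive.

Import Order.TTheory GRing.Theory Num.Theory.
Local Open Scope classical_set_scope.
Local Open Scope sesquilinear_scope.
Local Open Scope complex_scope.
Local Open Scope ring_scope.

(* C^m (x) C^n is encoded as 'cV_(m * n), with basis vector |i>|j> at position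
   mxtens_index (i, j) = i * n + j; operators tensor with *t accordingly. *)

(* In [0 <= z] for z : R[i] the order forces z to be real. *)
Definition psdmx (R : realType) (n : nat) (A : 'M[R[i]]_n) : Prop :=
  A \is hermsymmx /\ forall v : 'cV[R[i]]_n, 0 <= (v^t* *m A *m v) ord0 ord0.

Definition loewner_ge (R : realType) (n : nat) (A B : 'M[R[i]]_n) : Prop :=
  psdmx (A - B).

Definition is_state (R : realType) (d : nat) (rho : 'M[R[i]]_d) : Prop :=
  psdmx rho /\ \tr rho = 1.

Definition ptrace_l (R : realType) (m n : nat) (A : 'M[R[i]]_(m * n)) :
    'M[R[i]]_n :=
  \matrix_(i, j) \sum_(k < m) A (mxtens_index (k, i)) (mxtens_index (k, j)).

(* In C^d (x) C^d the first factor is the purifying system R, the second one is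
   the system A carrying rho. *)
Definition is_purification (R : realType) (d : nat) (rho : 'M[R[i]]_d)
    (phi : 'cV[R[i]]_(d * d)) : Prop :=
  (phi^t* *m phi) ord0 ord0 = 1 /\ ptrace_l (phi *m phi^t*) = rho.

Definition sdp_feasible (R : realType) (r d : nat) :
    set ('I_r -> 'M[R[i]]_d) :=
  [set Y | (forall i, psdmx (Y i)) /\
     loewner_ge (\sum_(i < r) (delta_mx i i *t Y i))
                (\sum_(i < r) \sum_(j < r | i != j)
                    (delta_mx i j *t (1%:M : 'M[R[i]]_d)))].

(* Each Tr[Y_i rho_i] is real on feasible points, so Re discards nothing.  The
   optimal values are taken in the extended reals: an infeasible or unbounded
   program is not sent to a default real value. *)
Definition F_SDP (R : realType) (r d : nat) (rho : 'I_r -> 'M[R[i]]_d) :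
    \bar R :=
  ((r%:R * (r%:R - 1))^-1%:E *
   ereal_inf [set (complex.Re (\sum_(i < r) \tr (Y i *m rho i)))%:E
             | Y in @sdp_feasible R r d])%E.

(* |psi> lives in C^r (x) (R (x) A); the cast by associativity keeps every
   coordinate at the same position and views it in (C^r (x) R) (x) A. *)
Definition purif_vec (R : realType) (r d : nat)
    (phi : 'I_r -> 'cV[R[i]]_(d * d)) : 'cV[R[i]]_(r * d * d) :=
  castmx (mulnA r d d, erefl 1%N)
    ((sqrtC (r%:R : R[i]))^-1 *:
       \sum_(i < r) ((delta_mx i ord0 : 'cV[R[i]]_r) *t phi i)).

Definition kstar_feasible (R : realType) (r d : nat) : set 'M[R[i]]_(r * d) :=
  [set K | psdmx K /\
     exists Kb : 'I_r -> 'I_r -> 'M[R[i]]_d,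
       K = (1%:M : 'M[R[i]]_r) *t (1%:M : 'M[R[i]]_d) +
           \sum_(i < r) \sum_(j < r | i != j) (delta_mx i j *t Kb i j)].

Definition F_Kstar (R : realType) (r d : nat)
    (phi : 'I_r -> 'cV[R[i]]_(d * d)) : \bar R :=
  ((r%:R - 1)^-1%:E *
   ereal_sup [set (complex.Re (((purif_vec phi)^t* *m
                      (K *t (1%:M : 'M[R[i]]_d)) *m purif_vec phi) ord0 ord0)
                   - 1)%:E
             | K in @kstar_feasible R r d])%E.

(* Main.v *)
Require Import Defs.
From mathcomp Require Import all_boot all_order all_algebra.
From mathcomp Require Import spectral mxtens complex.
From mathcomp Require Import boolp classical_sets functions reals.
From mathcomp Require Import constructive_ereal ereal topology normedtype derive.
From mathcomp Require Import ring lra.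

Set Implicit Arguments.
Unset Strict Implicit.
Unset Printing Implicit Defensive.

Import Order.TTheory GRing.Theory Num.Theory.
Import numFieldTopology.Exports numFieldNormedType.Exports.
Local Open Scope classical_set_scope.
Local Open Scope sesquilinear_scope.
Local Open Scope complex_scope.
Local Open Scope ring_scope.

Local Notation Re := (@complex.Re _).
Local Notation Im := (@complex.Im _).

(** Reshape the purification of [rho_i] into a matrix [Q_i] with
    [rho_i = Q_i Q_i^*], put [Q = diag(Q_1, ..., Q_r)] and
    [G = Q^* J Q], where [J] is the off-diagonal matrix of the SDP constraint.
    Up to a transposition of [K], the K*-objective is [tr (G K) / r].

    Weak duality: [tr ((diag Y - J) (Q K Q^* )) >= 0], a trace of two positive
    semi-definite matrices.

    Strong duality: the set of feasible [K] is compact, so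
    [(Re tr (G K) + c)^N * det K] attains its maximum on it, at an invertible
    [K].  Stationarity along Hermitian directions with zero diagonal blocks
    says that [D = G + mu K^-1] is block diagonal, with
    [mu = (Re tr (G K) + c) / N].  Then [D >= G] and
    [tr D = tr (D K) = tr (G K) + mu r d], a gap that vanishes as [N] grows.
    When all [Q_i] are invertible, [Y_i = Q_i^-* D_i Q_i^-1] is SDP-feasible
    with value [tr D].  In general [Q_i] is replaced by the invertible matrix
    [Q_i + t N_i] with [Q_i N_i^* = 0], which only increases [Q_i Q_i^*], hence
    the SDP value, and moves the K*-objective by [O(t)]. *)

(** * Real and imaginary parts of complex scalars *)

Section ReIm.
Variable R : realType.
Implicit Types x y : R[i].

Lemma cReD x y : Re (x + y) = Re x + Re y. Proof. by case: x; case: y. Qed.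
Lemma cReN x : Re (- x) = - Re x. Proof. by case: x. Qed.
Lemma cReB x y : Re (x - y) = Re x - Re y. Proof. by rewrite cReD cReN. Qed.
Lemma cReM x y : Re (x * y) = Re x * Re y - Im x * Im y.
Proof. by case: x; case: y. Qed.
Lemma cImD x y : Im (x + y) = Im x + Im y. Proof. by case: x; case: y. Qed.
Lemma cImM x y : Im (x * y) = Re x * Im y + Im x * Re y.
Proof. by case: x => a b; case: y => c d. Qed.
Lemma cReZ (t : R) x : Re (t%:C * x) = t * Re x.
Proof. by rewrite cReM /= mul0r subr0. Qed.
Lemma cRe_sum (I : Type) (s : seq I) (P : pred I) (F : I -> R[i]) :
  Re (\sum_(i <- s | P i) F i) = \sum_(i <- s | P i) Re (F i).
Proof. by apply: (big_morph Re) => // x y; rewrite cReD. Qed.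

Lemma conjC_complex x : x^*%R = (Re x) -i* (Im x).
Proof. by case: x. Qed.

Lemma cRe_conj x : Re (x^*%R) = Re x. Proof. by case: x. Qed.
Lemma cIm_conj x : Im (x^*%R) = - Im x. Proof. by case: x. Qed.

Lemma complex_eq x y : Re x = Re y -> Im x = Im y -> x = y.
Proof. by case: x => a b; case: y => c d /= -> ->. Qed.

Lemma ge0_ReP x : 0 <= x <-> Im x = 0 /\ 0 <= Re x.
Proof. by rewrite lecE /=; split=> [/andP[/eqP -> ->]|[-> ->]]; rewrite ?eqxx. Qed.

Lemma cRe_ge0 x : 0 <= x -> 0 <= Re x.
Proof. by case/ge0_ReP. Qed.

Lemma normr_Re_le x : `|Re x| <= Re `|x|.
Proof.
by rewrite normc_def /= -(sqrtr_sqr (Re x)) ler_wsqrtr // lerDl sqr_ge0.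
Qed.

Lemma normr_Im_le x : `|Im x| <= Re `|x|.
Proof.
by rewrite normc_def /= -(sqrtr_sqr (Im x)) ler_wsqrtr // lerDr sqr_ge0.
Qed.

Lemma self_conj_Im x : x^*%R = x -> Im x = 0.
Proof. by case: x => a b [] h /=; lra. Qed.

End ReIm.

(** * Positive semi-definite matrices *)

Section Adjoint.
Variable R : realType.
Local Notation C := R[i].

Lemma hadjM m n p (A : 'M[C]_(m, n)) (B : 'M_(n, p)) :
  (A *m B)^t* = B^t* *m A^t*.
Proof. by rewrite trmx_mul map_mxM. Qed.

Lemma hadjD m n (A B : 'M[C]_(m, n)) : (A + B)^t* = A^t* + B^t*.
Proof. by rewrite linearD /= map_mxD. Qed.

Lemma hadjN m n (A : 'M[C]_(m, n)) : (- A)^t* = - A^t*.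
Proof. by rewrite linearN /= map_mxN. Qed.

Lemma hadjB m n (A B : 'M[C]_(m, n)) : (A - B)^t* = A^t* - B^t*.
Proof. by rewrite hadjD hadjN. Qed.

Lemma hadjZ m n (t : R) (A : 'M[C]_(m, n)) : (t%:C *: A)^t* = t%:C *: A^t*.
Proof. by rewrite linearZ /= map_mxZ; congr (_ *: _); exact: conjc_real. Qed.

Lemma hadj1 n : (1%:M : 'M[C]_n)^t* = 1%:M.
Proof. by rewrite trmx1 map_mx1. Qed.

Lemma hadj_mxE m n (A : 'M[C]_(m, n)) i j : (A^t*) i j = ((A j i)^*)%R.
Proof. by rewrite !mxE. Qed.

Lemma hermsymmxE n (A : 'M[C]_n) : A \is hermsymmx <-> A^t* = A.
Proof.
split=> [/is_hermitianmxP|h].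
  by rewrite expr0 scale1r => {2}->.
by apply/is_hermitianmxP; rewrite expr0 scale1r.
Qed.

Lemma hadj_det n (A : 'M[C]_n) : \det (A^t*) = ((\det A)^*)%R.
Proof. by rewrite det_map_mx det_tr. Qed.

Lemma hadj_inv n (A : 'M[C]_n) : A \in unitmx -> (invmx A)^t* = invmx (A^t*).
Proof.
move=> Au; have Au' : A^t* \in unitmx by rewrite map_unitmx unitmx_tr.
have /(congr1 (mulmx^~ (invmx (A^t*)))) : (invmx A)^t* *m A^t* = 1%:M.
  by rewrite -hadjM mulmxV // hadj1.
by rewrite mulmxK // mul1mx.
Qed.

End Adjoint.

Section Psd.
Variable R : realType.
Local Notation C := R[i].

Lemma psdmx_herm n (A : 'M[C]_n) : psdmx A -> A^t* = A.
Proof. by case=> /hermsymmxE. Qed.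

Lemma psdmx_congr m n (A : 'M[C]_n) (B : 'M_(n, m)) :
  psdmx A -> psdmx (B^t* *m A *m B).
Proof.
move=> pA; split.
  by apply/hermsymmxE; rewrite !hadjM trmxCK (psdmx_herm pA) mulmxA.
move=> v; have [_ /(_ (B *m v))] := pA.
by rewrite hadjM !mulmxA.
Qed.

Lemma psdmxD n (A B : 'M[C]_n) : psdmx A -> psdmx B -> psdmx (A + B).
Proof.
move=> pA pB; split; first by apply/hermsymmxE; rewrite hadjD (psdmx_herm pA) (psdmx_herm pB).
move=> v; rewrite mulmxDr mulmxDl mxE addr_ge0 //.
  by case: pA.
by case: pB.
Qed.

Lemma psdmxZ n (t : R) (A : 'M[C]_n) : 0 <= t -> psdmx A -> psdmx (t%:C *: A).
Proof.
move=> t0 pA; split; first by apply/hermsymmxE; rewrite hadjZ (psdmx_herm pA).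
move=> v; rewrite -scalemxAr -scalemxAl mxE mulr_ge0 //; first by rewrite ler0c.
by case: pA.
Qed.

Lemma psdmx_entry_ge0 n (A : 'M[C]_n) i : psdmx A -> 0 <= A i i.
Proof.
case=> _ /(_ (delta_mx i ord0)).
have -> : (delta_mx i ord0 : 'cV[C]_n)^t* = delta_mx ord0 i.
  by rewrite trmx_delta map_delta_mx.
by rewrite -rowE -colE !mxE.
Qed.

Lemma psdmx_diag n (l : 'rV[C]_n) : (forall k, 0 <= l 0 k) -> psdmx (diag_mx l).
Proof.
move=> l0; split.
  apply/hermsymmxE/matrixP => i j; rewrite hadj_mxE !mxE.
  rewrite eq_sym; case: eqP => [->|_]; rewrite ?mulr0n ?conjC0 // !mulr1n.
  by apply/CrealP/ger0_real.
move=> v; rewrite mul_mx_diag !mxE sumr_ge0 // => k _.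
rewrite !mxE mulrAC mulr_ge0 // mulrC mul_conjC_ge0 //.
Qed.

Lemma psdmx1 n : psdmx (1%:M : 'M[C]_n).
Proof.
rewrite -diag_const_mx; apply: psdmx_diag => k.
by rewrite mxE ler01.
Qed.

Lemma herm_spectral n (A : 'M[C]_n) : A^t* = A ->
  exists (P : 'M[C]_n) (l : 'I_n -> R),
    [/\ P *m P^t* = 1%:M, P^t* *m P = 1%:M &
        A = P^t* *m diag_mx (\row_k (l k)%:C) *m P].
Proof.
move=> /hermsymmxE hA.
have /orthomx_spectralP AE := hermitian_normalmx hA.
have lR := hermitian_spectral_diag_real hA.
have uP := spectral_unitarymx A.
exists (spectralmx A), (fun k => Re (spectral_diag A 0 k)); split.
- exact/unitarymxP.
- apply: mulmx1C; exact/unitarymxP.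
set l := \row_k _; have -> : l = spectral_diag A.
  by apply/rowP => k; rewrite mxE RRe_real //; apply/mxOverP.
by rewrite -invmx_unitary.
Qed.

(** Diagonalising [A] turns the trace into a sum of eigenvalues of [A] times diagonal entries of a
    conjugate of [B], all nonnegative. *)
Lemma psdmx_tr_mul_ge0 n (A B : 'M[C]_n) : psdmx A -> psdmx B ->
  0 <= \tr (A *m B).
Proof.
move=> pA pB; have [P [l [PP' P'P AE]]] := herm_spectral (psdmx_herm pA).
have DE : diag_mx (\row_k (l k)%:C) = (P^t*)^t* *m A *m P^t*.
  by rewrite AE trmxCK !mulmxA PP' mul1mx -mulmxA PP' mulmx1.
have -> : \tr (A *m B) = \tr (diag_mx (\row_k (l k)%:C) *m (P *m B *m P^t*)).
  by rewrite [in LHS]AE -!mulmxA mxtrace_mulC !mulmxA.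
rewrite sumr_ge0 // => k _; rewrite mul_diag_mx mxE mulr_ge0 //.
  have := psdmx_entry_ge0 k (psdmx_congr (P^t*) pA).
  by rewrite -DE !mxE eqxx mulr1n.
rewrite -{1}[P]trmxCK; exact: psdmx_entry_ge0 (psdmx_congr _ pB).
Qed.

Lemma herm_shift_psd n (A : 'M[C]_n) : A^t* = A ->
  exists2 h : R, 0 < h & psdmx (A + (h%:C)%:M).
Proof.
move=> /herm_spectral[P [l [PP' P'P AE]]].
exists (1 + \sum_k `|l k|); first by rewrite ltr_pwDl // sumr_ge0.
have -> : A + ((1 + \sum_k `|l k|)%:C)%:M =
    P^t* *m diag_mx (\row_k (l k + (1 + \sum_j `|l j|))%:C) *m P.
  have -> : diag_mx (\row_k (l k + (1 + \sum_j `|l j|))%:C) =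
      diag_mx (\row_k (l k)%:C) + ((1 + \sum_j `|l j|)%:C)%:M.
    rewrite -diag_const_mx -linearD /=; congr diag_mx; apply/rowP => k.
    by rewrite !mxE rmorphD.
  by rewrite mulmxDr mulmxDl -AE scalar_mxC -mulmxA P'P mulmx1.
apply/psdmx_congr/psdmx_diag => k; rewrite mxE ler0c.
rewrite (bigD1 k) //=.
have : 0 <= \sum_(i < n | i != k) `|l i| by rewrite sumr_ge0.
have := lerNnormlW (lexx `|l k|); lra.
Qed.

Lemma psdmx_unit_shift n (A : 'M[C]_n) : psdmx A -> A \in unitmx ->
  exists2 h : R, 0 < h & psdmx (A - (h%:C)%:M).
Proof.
move=> pA uA; have [P [l [PP' P'P AE]]] := herm_spectral (psdmx_herm pA).
have DE : diag_mx (\row_k (l k)%:C) = (P^t*)^t* *m A *m P^t*.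
  by rewrite AE trmxCK !mulmxA PP' mul1mx -mulmxA PP' mulmx1.
have l0 k : 0 < l k.
  rewrite lt_neqAle; apply/andP; split; last first.
    have := psdmx_entry_ge0 k (psdmx_congr (P^t*) pA).
    by rewrite -DE !mxE eqxx mulr1n ler0c.
  have : \det (diag_mx (\row_k (l k)%:C)) != 0.
    rewrite DE trmxCK; apply/eqP => d0.
    have : P *m A *m P^t* \in unitmx.
      rewrite !unitmx_mul uA andbT /=; case/mulmx1_unit: PP' => -> /=.
      by move=> ->.
    by rewrite unitmxE d0 unitr0.
  rewrite det_diag => /prodf_neq0 /(_ k isT); rewrite mxE.
  by apply: contraNneq => <-.
(* [s] dominates every inverse eigenvalue, so [s^-1] lies below the whole spectrum; the summand 1
   keeps [s] positive in dimension 0. *)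
pose s := 1 + \sum_k (l k)^-1.
have s0 : 0 < s by rewrite ltr_pwDl // sumr_ge0 // => k _; rewrite invr_ge0 ltW.
exists s^-1; first by rewrite invr_gt0.
have -> : A - ((s^-1)%:C)%:M =
    P^t* *m diag_mx (\row_k (l k - s^-1)%:C) *m P.
  have -> : diag_mx (\row_k (l k - s^-1)%:C) =
      diag_mx (\row_k (l k)%:C) - ((s^-1)%:C)%:M.
    rewrite -diag_const_mx -linearB /=; congr diag_mx; apply/rowP => k.
    by rewrite !mxE rmorphB.
  by rewrite mulmxBr mulmxBl -AE scalar_mxC -mulmxA P'P mulmx1.
apply/psdmx_congr/psdmx_diag => k; rewrite mxE ler0c subr_ge0.
rewrite invf_ple ?posrE //= /s (bigD1 k) //= addrCA lerDl.
by rewrite addr_ge0 // sumr_ge0 // => j _; rewrite invr_ge0 ltW.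
Qed.

(** Makes two-sided variations around an invertible maximizer admissible. With [K >= k] and
    [X + x >= 0], for [X = H] or [X = - H], the matrix [K + |t| X] splits as
    [(K - k) + |t| (X + x) + (k - |t| x)]. *)
Lemma psdmx_perturb n (K H : 'M[C]_n) : psdmx K -> K \in unitmx -> H^t* = H ->
  exists2 e : R, 0 < e & forall t, `|t| < e -> psdmx (K + t%:C *: H).
Proof.
move=> pK uK hH; have [k k0 pk] := psdmx_unit_shift pK uK.
have [h h0 ph] := herm_shift_psd hH.
have [h' h'0 ph'] : exists2 h : R, 0 < h & psdmx (- H + (h%:C)%:M).
  by apply: herm_shift_psd; rewrite hadjN hH.
exists (k / (h + h')); first by rewrite divr_gt0 // addr_gt0.
move=> t; rewrite ltr_pdivlMr; last exact: addr_gt0.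
move=> tk.
have t0 := normr_ge0 t.
have key (X : 'M[C]_n) (x : R) : 0 < x -> x <= h + h' -> psdmx (X + (x%:C)%:M) ->
    psdmx (K + `|t|%:C *: X).
  move=> x0 xh pX.
  have -> : K + `|t|%:C *: X = (K - (k%:C)%:M) + `|t|%:C *: (X + (x%:C)%:M)
     + (k - `|t| * x)%:C *: 1%:M.
    rewrite rmorphB rmorphM /=; apply/matrixP => i j; rewrite !mxE.
    by case: (i == j); rewrite ?mulr1n ?mulr0n; ring.
  apply: psdmxD; first exact: psdmxD pk (psdmxZ t0 pX).
  apply: psdmxZ; last exact: psdmx1.
  rewrite subr_ge0.
  by rewrite (le_trans _ (ltW tk)) // ler_wpM2l.
case: (leP 0 t) => tge; first by rewrite -(ger0_norm tge); apply: (key _ h _ _ ph); lra.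
have -> : t%:C *: H = `|t|%:C *: (- H).
  by rewrite ltr0_norm // scalerN -scaleNr -rmorphN opprK.
by apply: (key _ h' _ _ ph'); lra.
Qed.

Lemma psdmx_inv n (K : 'M[C]_n) : psdmx K -> K \in unitmx -> psdmx (invmx K).
Proof.
move=> pK uK; have := psdmx_congr (invmx K) pK.
by rewrite (hadj_inv uK) (psdmx_herm pK) (mulVmx uK) mul1mx.
Qed.

(** The quadratic form at [e_i - conj(K_ij) e_j] equals [1 - |K_ij|^2]. The bound makes the feasible
    set compact. *)
Lemma psdmx_entry_le1 n (K : 'M[C]_n) i j : psdmx K -> K i i = 1 -> K j j = 1 ->
  `|K i j| <= 1.
Proof.
move=> pK Ki Kj.
have hK : K j i = ((K i j)^*)%R by rewrite -{1}(psdmx_herm pK) hadj_mxE.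
pose v : 'cV[C]_n := delta_mx i ord0 - (K i j)^*%R *: delta_mx j ord0.
have [_ /(_ v)] := pK.
have q a b : ((delta_mx a ord0 : 'cV[C]_n)^t* *m K *m (delta_mx b ord0 : 'cV[C]_n)) ord0 ord0
     = K a b.
  rewrite trmx_delta map_delta_mx -rowE.
  by rewrite -colE !mxE.
have -> : v^t* = (delta_mx i ord0 : 'cV[C]_n)^t* -
     K i j *: (delta_mx j ord0 : 'cV[C]_n)^t*.
  by rewrite hadjB linearZ /= map_mxZ /= conjCK.
have bil (a b : 'rV[C]_n) (x y : 'cV[C]_n) (k l : C) :
    ((a - k *: b) *m K *m (x - l *: y)) ord0 ord0 =
    (a *m K *m x) ord0 ord0 - l * (a *m K *m y) ord0 ord0
    - k * (b *m K *m x) ord0 ord0 + k * l * (b *m K *m y) ord0 ord0.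
  rewrite mulmxBl !mulmxBr !mulmxBl -(scalemxAl k b K).
  rewrite -(scalemxAl k _ x) -!(scalemxAr l) -(scalemxAl k _ y) scalerA.
  by rewrite !mxE; ring.
rewrite /v bil !q Ki Kj hK mulr1.
rewrite subrK mulrC.
by rewrite -normCK subr_ge0 expr_le1.
Qed.

End Psd.

(** * The barrier argument *)

(** The polynomial is the characteristic polynomial [c] of [- A] with reversed coefficients: in
    dimension m, [det (1 + t A) = t^m c(1/t)]. The leading and trace coefficients of [c] move to
    degrees 0 and 1. *)
Lemma det_1D_poly (F : fieldType) n (A : 'M[F]_n) :
  exists P : {poly F}, [/\ P`_0 = 1, P`_1 = \tr A &
    forall t, \det (1%:M + t *: A) = P.[t]].
Proof.
case: n => [|n] in A *.
  exists 1; split; rewrite ?coef1 ?/mxtrace ?big_ord0 // => t.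
  by rewrite det_mx00 hornerC.
pose c := char_poly (- A); have sc : size c = n.+2 by exact: size_char_poly.
exists (\poly_(k < n.+2) c`_(n.+1 - k)); split.
- rewrite coef_poly /= subn0.
  by have /monicP := char_poly_monic (- A); rewrite lead_coefE -/c sc.
- rewrite coef_poly /= subn1 /= (char_poly_trace (- A) (ltn0Sn n)).
  by rewrite linearN opprK.
move=> t; have [->|t0] := eqVneq t 0.
  rewrite scale0r addr0 det1 horner_coef0 coef_poly /= subn0.
  by have /monicP := char_poly_monic (- A); rewrite lead_coefE -/c sc.
have -> : 1%:M + t *: A = t *: (t^-1%:M + A).
  by rewrite scalerDr scale_scalar_mx mulfV.
have -> : t^-1%:M + A = map_mx (horner_eval t^-1) (char_poly_mx (- A)).
  by apply/matrixP => i j; rewrite !mxE /horner_eval !hornerE; case: (i == j); rewrite /= ?hornerE opprK.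
rewrite detZ; have -> : \det (map_mx (horner_eval t^-1) (char_poly_mx (- A))) = c.[t^-1].
  by rewrite det_map_mx.
rewrite horner_poly horner_coef sc big_distrr /= (reindex_inj rev_ord_inj) /=.
apply: eq_bigr => i _; rewrite subSS mulrCA; congr (_ * _).
have i_le : (i <= n.+1)%N by rewrite -ltnS.
rewrite -{1}(subnK i_le) exprD exprVn mulrAC mulfV ?mul1r //.
by rewrite expf_neq0.
Qed.

(** Fermat's rule at an interior maximum: the coefficient of degree 1 is the derivative at 0. *)
Lemma poly_local_max (R : realType) (p : {poly R}) (e : R) : 0 < e ->
  (forall t, `|t| < e -> p.[t] <= p.[0]) -> p`_1 = 0.
Proof.
move=> e0 h.
have inE t : t \in `]- e, e[ -> `|t| < e by rewrite in_itv /= ltr_norml.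
have d0 := @derive1_at_max R (horner p) (- e) e 0.
have D0 : is_derive (0 : R) 1 (horner p) 0.
  apply: d0; first lra.
  - by move=> t _; apply: derivable_horner.
  - by rewrite in_itv /=; apply/andP; split; lra.
  - by move=> t /inE; exact: h.
have := @derive_val _ _ _ _ _ _ _ (is_derive_poly p 0).
by rewrite (@derive_val _ _ _ _ _ _ _ D0) horner_coef0 coef_deriv mulr1n.
Qed.

(** * Continuity of complex-valued functions *)

Section ReIm_continuity.
Variables (R : realType) (T : topologicalType).

Lemma continuous_fun_add (f g : T -> R) : continuous f -> continuous g ->
  continuous (fun x => f x + g x).
Proof. by move=> cf cg x; apply: cvgD; [apply: cf|apply: cg]. Qed.

Lemma continuous_fun_sub (f g : T -> R) : continuous f -> continuous g ->
  continuous (fun x => f x - g x).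
Proof. by move=> cf cg x; apply: cvgB; [apply: cf|apply: cg]. Qed.

Lemma continuous_fun_mul (f g : T -> R) : continuous f -> continuous g ->
  continuous (fun x => f x * g x).
Proof. by move=> cf cg x; apply: cvgM; [apply: cf|apply: cg]. Qed.

Lemma continuous_fun_exp (f : T -> R) N : continuous f ->
  continuous (fun x => f x ^+ N).
Proof.
move=> cf; elim: N => [|N IH].
  by under [X in continuous X]funext do rewrite expr0; apply: cst_continuous.
by under [X in continuous X]funext do rewrite exprS; apply: continuous_fun_mul.
Qed.

Implicit Types f g : T -> R[i].

(** Stated on the two real coordinates, so that only the topology of [R] enters. *)
Definition ccontinuous f :=
  continuous (fun x => Re (f x)) /\ continuous (fun x => Im (f x)).

Lemma ccontinuous_cst (c : R[i]) : ccontinuous (fun=> c).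
Proof. by split; apply: cst_continuous. Qed.

Lemma ccontinuousD f g : ccontinuous f -> ccontinuous g ->
  ccontinuous (fun x => f x + g x).
Proof.
move=> [rf jf] [rg jg]; split.
  under [X in continuous X]funext do rewrite cReD.
  exact: continuous_fun_add.
under [X in continuous X]funext do rewrite cImD.
exact: continuous_fun_add.
Qed.

Lemma ccontinuousM f g : ccontinuous f -> ccontinuous g ->
  ccontinuous (fun x => f x * g x).
Proof.
move=> [rf jf] [rg jg]; split.
  under [X in continuous X]funext do rewrite cReM.
  by apply: continuous_fun_sub; apply: continuous_fun_mul.
under [X in continuous X]funext do rewrite cImM.
by apply: continuous_fun_add; apply: continuous_fun_mul.
Qed.

Lemma ccontinuous_sum (I : Type) (s : seq I) (F : I -> T -> R[i]) :
  (forall i, ccontinuous (F i)) -> ccontinuous (fun x => \sum_(i <- s) F i x).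
Proof.
move=> h; elim: s => [|i s IH].
  under [X in ccontinuous X]funext do rewrite big_nil.
  exact: ccontinuous_cst.
under [X in ccontinuous X]funext do rewrite big_cons.
exact: ccontinuousD.
Qed.

Lemma ccontinuous_prod (I : Type) (s : seq I) (F : I -> T -> R[i]) :
  (forall i, ccontinuous (F i)) -> ccontinuous (fun x => \prod_(i <- s) F i x).
Proof.
move=> h; elim: s => [|i s IH].
  under [X in ccontinuous X]funext do rewrite big_nil.
  exact: ccontinuous_cst.
under [X in ccontinuous X]funext do rewrite big_cons.
exact: ccontinuousM.
Qed.

Lemma ccontinuous_mulmx m n p (A : T -> 'M[R[i]]_(m, n)) (B : T -> 'M_(n, p)) :
  (forall i j, ccontinuous (fun x => A x i j)) ->
  (forall i j, ccontinuous (fun x => B x i j)) ->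
  forall i j, ccontinuous (fun x => (A x *m B x) i j).
Proof.
move=> hA hB i j; under [X in ccontinuous X]funext do rewrite mxE.
by apply: ccontinuous_sum => k; apply: ccontinuousM.
Qed.

Lemma ccontinuous_det n (A : T -> 'M[R[i]]_n) :
  (forall i j, ccontinuous (fun x => A x i j)) -> ccontinuous (fun x => \det (A x)).
Proof.
move=> hA; apply: ccontinuous_sum => s.
apply: ccontinuousM; first exact: ccontinuous_cst.
exact: ccontinuous_prod.
Qed.

Lemma closed_forall (I : Type) (A : I -> set T) :
  (forall i, closed (A i)) -> closed [set x | forall i, A i x].
Proof.
move=> h; have -> : [set x | forall i, A i x] = \bigcap_i A i.
  by apply/seteqP; split => x /= H i //; apply: H.
by apply: closed_bigI => i _.
Qed.

Lemma closed_Re_ge0 f : ccontinuous f -> closed [set x | 0 <= Re (f x)].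
Proof. by case=> rf _; apply: (closed_comp _ (@closed_ge R 0)) => x _; apply: rf. Qed.

Lemma closed_eq_complex f (c : R[i]) : ccontinuous f -> closed [set x | f x = c].
Proof.
case=> rf jf; have -> : [set x | f x = c] =
   (fun x => Re (f x)) @^-1` [set y | y = Re c] `&` (fun x => Im (f x)) @^-1` [set y | y = Im c].
  by apply/seteqP; split => x /= => [->//|[]]; apply: complex_eq.
apply: closedI; apply: (closed_comp _ (@closed_eq R _)) => x _.
  exact: rf.
exact: jf.
Qed.

End ReIm_continuity.

(** * Real coordinates on Hermitian matrices *)

Section HermitianCoordinates.
Variables (R : realType) (n : nat).
Local Notation C := R[i].

(* Hermitian matrices are coordinatised by all real n x n matrices S, through
   S_kl = Re K_kl + Im K_kl, so that compactness is needed in R^(n*n) only. *)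
Definition herm_of (s : 'rV[R]_(n * n)) : 'M[C]_n :=
  \matrix_(k, l) ((vec_mx s k l + vec_mx s l k) / 2 +i*
                  ((vec_mx s k l - vec_mx s l k) / 2)).

Definition coord_of (K : 'M[C]_n) : 'rV[R]_(n * n) :=
  mxvec (\matrix_(k, l) (Re (K k l) + Im (K k l))).

Lemma herm_of_adj s : (herm_of s)^t* = herm_of s.
Proof.
apply/matrixP => i j; rewrite hadj_mxE /herm_of [LHS]conjC_complex !mxE /=.
by congr (_ +i* _); [congr (_ / _); rewrite addrC|rewrite -mulNr opprB].
Qed.

(** For Hermitian [K] the real part is symmetric and the imaginary part antisymmetric, so their sum
    determines both. *)
Lemma coord_ofK K : K^t* = K -> herm_of (coord_of K) = K.
Proof.
move=> hK; apply/matrixP => i j.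
have hij : K j i = ((K i j)^*)%R by rewrite -{1}hK hadj_mxE.
rewrite /herm_of /coord_of mxvecK !mxE hij cRe_conj cIm_conj.
by apply: complex_eq => /=; field.
Qed.

Lemma ccontinuous_herm_of k l : ccontinuous (fun s => herm_of s k l).
Proof.
have cc i j : continuous (fun s : 'rV[R]_(n * n) => vec_mx s i j).
  under [X in continuous X]funext do rewrite mxE.
  exact: coord_continuous.
split; under [X in continuous X]funext do rewrite mxE /=.
  by apply: continuous_fun_mul; last (exact: cst_continuous); apply: continuous_fun_add.
by apply: continuous_fun_mul; last (exact: cst_continuous); apply: continuous_fun_sub.
Qed.

End HermitianCoordinates.

(** The diagonal blocks are identities; [blk] gives the block of an index, which keeps the barrier
    argument free of tensor indexing. *)
Definition block_feasible (R : realType) (n : nat) (I : eqType) (blk : 'I_n -> I)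
    (K : 'M[R[i]]_n) :=
  psdmx K /\ forall a b, blk a = blk b -> K a b = (a == b)%:R.

(** * Existence of a maximizer of the barrier function *)

Section Maximizer.
Variables (R : realType) (n : nat) (I : eqType) (blk : 'I_n -> I).
Local Notation C := R[i].
Local Notation feasible := (@block_feasible R n I blk).

Lemma feasible_entry_le1 (K : 'M[C]_n) i j : feasible K -> `|K i j| <= 1.
Proof.
by move=> [pK bK]; apply: psdmx_entry_le1 => //; rewrite bK // eqxx.
Qed.

Lemma coord_of_bound (K : 'M[C]_n) k : feasible K -> `|coord_of K 0 k| <= 2.
Proof.
move=> hK; case/mxvec_indexP: k => i j; rewrite /coord_of mxvecE mxE.
have le1 : Re `|K i j| <= 1.
  by have := feasible_entry_le1 i j hK; rewrite lecE => /andP[].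
have := normr_Re_le (K i j); have := normr_Im_le (K i j).
by have := ler_normD (Re (K i j)) (Im (K i j)); lra.
Qed.

(** Extreme value theorem in real coordinates: the feasible set is bounded entrywise, closed, and
    contains the identity. *)
Lemma feasible_maximizer (G : 'M[C]_n) (c : R) (N : nat) :
  exists2 K, feasible K & forall K', feasible K' ->
    (Re (\tr (G *m K')) + c) ^+ N * Re (\det K') <=
    (Re (\tr (G *m K)) + c) ^+ N * Re (\det K).
Proof.
pose f (s : 'rV[R]_(n * n)) :=
  (Re (\tr (G *m herm_of s)) + c) ^+ N * Re (\det (herm_of s)).
(* The bound 2 is that of [|Re K_kl| + |Im K_kl|] when [|K_kl| <= 1]. *)
pose box := [set s : 'rV[R]_(n * n) | forall k, `[- 2, 2]%classic (s 0 k)].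
pose A := [set s : 'rV[R]_(n * n) | feasible (herm_of s)].
have cE i j : ccontinuous (fun s : 'rV[R]_(n * n) => herm_of s i j).
  exact: ccontinuous_herm_of.
have cf : continuous f.
  have [rd _] := ccontinuous_det cE.
  have [rt _] : ccontinuous (fun s : 'rV[R]_(n * n) => \tr (G *m herm_of s)).
    apply: ccontinuous_sum => i; apply: ccontinuous_mulmx => // k l.
    exact: ccontinuous_cst.
  apply: continuous_fun_mul; last exact: rd.
  apply: continuous_fun_exp; apply: continuous_fun_add; first exact: rt.
  exact: cst_continuous.
have clA : closed A.
  (* [herm_of s] is Hermitian by construction, so its quadratic form is real and only the sign of
     the real part remains, a closed condition. *)
  have -> : A =
      [set s | forall v : 'cV[C]_n,
         0 <= Re ((v^t* *m herm_of s *m v) ord0 ord0)] `&`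
      [set s | forall a b, [set s | blk a = blk b ->
         herm_of s a b = (a == b)%:R] s].
    apply/seteqP; split => s /=.
      by move=> [[_ p] b]; split => // v; apply: cRe_ge0.
    move=> [p b]; split=> //; split; first by apply/hermsymmxE/herm_of_adj.
    move=> v; apply/ge0_ReP; split=> //; apply: self_conj_Im.
    by rewrite -hadj_mxE !hadjM trmxCK herm_of_adj mulmxA.
  apply: closedI.
    apply: closed_forall => v; apply: closed_Re_ge0.
    apply: ccontinuous_mulmx => [k l|k l]; last exact: ccontinuous_cst.
    by apply: ccontinuous_mulmx => // k' l'; exact: ccontinuous_cst.
  apply: closed_forall => a; apply: closed_forall => b.
  apply: closed_forall => _; apply: closed_eq_complex; exact: cE.
have cA : compact (box `&` A).
  apply: compact_closedI => //.
  apply: (@rV_compact R (n * n) (fun=> `[- 2, 2]%classic)) => _.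
  exact: segment_compact.
have inA K : feasible K -> (box `&` A) (coord_of K).
  move=> fK; split; last by rewrite /A /= coord_ofK //; apply: psdmx_herm; case: fK.
  move=> k /=; rewrite in_itv /= -ler_norml.
  exact: coord_of_bound.
have feasible1 : feasible 1%:M.
  by split; [exact: psdmx1|move=> a b _; rewrite mxE].
have [|s] := @EVT_max_rV R _ f (box `&` A) _ cA (continuous_subspaceT cf).
  by exists (coord_of 1%:M); exact: inA.
rewrite inE => -[_ sA] smax; exists (herm_of s) => // K fK.
have := smax (coord_of K); rewrite inE => /(_ (inA _ fK)).
by rewrite /f coord_ofK //; apply: psdmx_herm; case: fK.
Qed.

End Maximizer.

(** Jacobi's formula along a line: factor out [K] and use the expansion at the identity. *)
Lemma det_pencil_poly (F : fieldType) n (K H : 'M[F]_n) : K \in unitmx ->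
  exists P : {poly F}, [/\ P`_0 = \det K, P`_1 = \det K * \tr (invmx K *m H) &
    forall t, \det (K + t *: H) = P.[t]].
Proof.
move=> uK; have [P [P0 P1 PE]] := det_1D_poly (invmx K *m H).
exists (\det K *: P); split; rewrite ?coefZ ?P0 ?P1 ?mulr1 // => t.
rewrite hornerZ -PE -det_mulmx mulmxDr mulmx1 -scalemxAr mulmxA mulmxV //.
by rewrite mul1mx.
Qed.

(** Turns the determinant along a real line into a real polynomial, to which calculus on [R]
    applies. *)
Lemma map_poly_Re_horner (R : realType) (P : {poly R[i]}) (t : R) :
  (map_poly Re P).[t] = Re P.[t%:C].
Proof.
rewrite (@horner_coef_wide _ (size P)) ?size_poly // horner_coef cRe_sum.
apply: eq_bigr => i _; rewrite coef_map_id0 // -rmorphXn /= mulrC.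
by rewrite [in RHS]mulrC cReZ.
Qed.

Lemma tr_mul_Re_bound (R : realType) n (X K : 'M[R[i]]_n) :
  (forall i j, `|K i j| <= 1) ->
  `|Re (\tr (X *m K))| <= \sum_i \sum_j Re `|X i j|.
Proof.
move=> hK; rewrite cRe_sum (le_trans (ler_norm_sum _ _ _)) // ler_sum // => i _.
rewrite mxE cRe_sum (le_trans (ler_norm_sum _ _ _)) // ler_sum // => j _.
rewrite (le_trans (normr_Re_le _)) //.
have : `|X i j * K j i| <= `|X i j| by rewrite normrM ler_piMr.
by rewrite lecE => /andP[].
Qed.

Lemma scale_cancel (R : realType) (V : lmodType R[i]) (x y : R) (u v : V) :
  x != 0 -> x^-1%:C *: (x%:C *: u + y%:C *: v) = u + (x^-1 * y)%:C *: v.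
Proof.
by move=> x0; rewrite scalerDr !scalerA -!rmorphM /= mulVf // rmorph1 scale1r.
Qed.

(** * Stationarity at the maximizer and the resulting duality gap *)

Section Barrier.
Variables (R : realType) (n : nat) (I : eqType) (blk : 'I_n -> I).
Local Notation C := R[i].
Local Notation feasible := (@block_feasible R n I blk).

Lemma feasible1 : feasible 1%:M.
Proof. by split; [exact: psdmx1|move=> a b _; rewrite mxE]. Qed.

(** [K + t H] is feasible for small [t] of either sign, so the barrier has zero derivative at
    [t = 0]. *)
Lemma barrier_stationary (G K H : 'M[C]_n) (c : R) (N : nat) :
  feasible K -> K \in unitmx ->
  (forall K', feasible K' ->
    (Re (\tr (G *m K')) + c) ^+ N.+1 * Re (\det K') <=
    (Re (\tr (G *m K)) + c) ^+ N.+1 * Re (\det K)) ->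
  Re (\tr (G *m K)) + c != 0 ->
  H^t* = H -> (forall a b, blk a = blk b -> H a b = 0) ->
  N.+1%:R * Re (\tr (G *m H)) +
    (Re (\tr (G *m K)) + c) * Re (\tr (invmx K *m H)) = 0.
Proof.
set a := _ + c; set b := Re (\tr (G *m H)).
move=> [pK bK] uK Kmax a0 hH bH.
have [e e0 pt] := psdmx_perturb pK uK hH.
have [P [P0 P1 PE]] := det_pencil_poly H uK.
have Imdet : Im (\det K) = 0.
  by apply: self_conj_Im; rewrite -hadj_det (psdmx_herm pK).
have det0 : Re (\det K) != 0.
  apply/eqP => h; have d0 : \det K = 0 by apply: complex_eq.
  by move: uK; rewrite unitmxE d0 unitr0.
pose p := (a%:P + b *: 'X) ^+ N.+1 * map_poly Re P.
have pE t : p.[t] = (Re (\tr (G *m (K + t%:C *: H))) + c) ^+ N.+1 *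
     Re (\det (K + t%:C *: H)).
  rewrite hornerM map_poly_Re_horner -PE; congr (_ * _).
  rewrite horner_exp hornerD hornerC hornerZ hornerX; congr (_ ^+ _).
  by rewrite mulmxDr -scalemxAr linearD linearZ /= cReD cReZ /a /b; ring.
have p1 : p`_1 = 0.
  apply: (poly_local_max e0) => t te; rewrite !pE [X in _ <= X]/= .
  rewrite rmorph0 scale0r addr0; apply: Kmax; split; first exact: pt.
  by move=> i j hij; rewrite !mxE (bK _ _ hij) (bH _ _ hij) mulr0 addr0.
(* The exponent [N.+1] leaves [a ^+ N] after differentiation, and [\det K] is real; both of these
   factors are nonzero. *)
have : p`_1 = a ^+ N * Re (\det K) * (N.+1%:R * b + a * Re (\tr (invmx K *m H))).
  have -> : p`_1 = (p^`()).[0] by rewrite horner_coef0 coef_deriv mulr1n.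
  rewrite /p derivM deriv_exp derivD derivC derivZ derivX add0r /=.
  rewrite hornerD !hornerM hornerMn hornerM !horner_exp !hornerE /=.
  rewrite !horner_coef0 coef_deriv !coef_map_id0 // P0 P1 mulr1n.
  by rewrite cReM Imdet mul0r subr0 exprS -mulr_natl; ring.
rewrite p1 => /esym/eqP; rewrite !mulf_eq0 expf_eq0 (negPf a0) (negPf det0) andbF.
by move=> /eqP.
Qed.

(** Tested against its own off-block part, [W] gives the sum of the squared moduli of its off-block
    entries. *)
Lemma herm_block_diagonal (W : 'M[C]_n) : W^t* = W ->
  (forall H : 'M[C]_n, H^t* = H -> (forall a b, blk a = blk b -> H a b = 0) ->
    Re (\tr (W *m H)) = 0) ->
  forall a b, blk a != blk b -> W a b = 0.
Proof.
move=> hW h a b ab.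
pose H := \matrix_(i, j) (if blk i == blk j then 0 else W i j).
have WE i j : W j i = ((W i j)^*)%R by rewrite -{1}hW hadj_mxE.
have hH : H^t* = H.
  apply/matrixP => i j; rewrite hadj_mxE !mxE eq_sym.
  by case: ifP => _; rewrite ?conjC0 // -WE.
have : Re (\tr (W *m H)) = 0.
  by apply: h hH _ => i j ij; rewrite mxE ij eqxx.
rewrite cRe_sum.
have sE i : Re ((W *m H) i i) =
   \sum_j (if blk i == blk j then 0 else Re (`|W i j| ^+ 2)).
  rewrite mxE cRe_sum; apply: eq_bigr => j _; rewrite mxE eq_sym.
  by case: ifP => _; rewrite ?mulr0 // WE -normCK.
have pos i j : 0 <= (if blk i == blk j then 0 else Re (`|W i j| ^+ 2)).
  by case: ifP => // _; apply: cRe_ge0; rewrite exprn_ge0.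
move=> /psumr_eq0P s0.
have := s0 _ a isT; rewrite sE => s1.
have /s1/psumr_eq0P s2 : forall i : 'I_n, true -> 0 <= Re ((W *m H) i i).
  by move=> i _; rewrite sE sumr_ge0.
have := s2 (fun j _ => pos a j) b isT; rewrite (negPf ab) => r0.
have /eqP : `|W a b| ^+ 2 = 0.
  apply: complex_eq => //; apply/self_conj_Im/CrealP.
  by rewrite realX // normr_real.
by rewrite sqrf_eq0 normr_eq0 => /eqP.
Qed.

Lemma barrier_gap (G : 'M[C]_n) (eps : R) : G^t* = G -> 0 < eps ->
  exists K (D : 'M[C]_n), [/\ feasible K, forall a b, blk a != blk b -> D a b = 0,
    psdmx (D - G) & Re (\tr D) <= Re (\tr (G *m K)) + eps].
Proof.
move=> hG eps0; pose g := \sum_i \sum_j Re `|G i j|.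
have gb K : feasible K -> `|Re (\tr (G *m K))| <= g.
  by move=> fK; apply: tr_mul_Re_bound => i j; apply: feasible_entry_le1 fK.
have g0 : 0 <= g by apply: le_trans (gb _ feasible1).
(* The gap will be [a n / N.+1] with [a <= 2 g + 1], hence at most [eps] once [N.+1] exceeds [B]. *)
pose B := (2 * g + 1) * n%:R / eps.
have B0 : 0 <= B by rewrite divr_ge0 ?(ltW eps0) // mulr_ge0 //; lra.
have [N hN] : exists N : nat, B < N.+1%:R.
  by exists (Num.truncn B); rewrite truncnS_gt.
(* The shift [g + 1] keeps the base of the power in [[1, 2 g + 1]] on the whole feasible set. *)
have [K fK Kmax] := feasible_maximizer blk G (g + 1) N.+1.
have fpos K' : feasible K' -> 1 <= Re (\tr (G *m K')) + (g + 1) <= 2 * g + 1.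
  by move=> /gb; rewrite ler_norml => /andP[]; lra.
set a := Re (\tr (G *m K)) + (g + 1) in Kmax.
have /andP[a1 a2] : 1 <= a <= 2 * g + 1 by exact: fpos.
(* Comparison with the identity, of determinant 1, rules out a singular maximizer. *)
have det_pos : 0 < Re (\det K).
  have := Kmax _ feasible1; rewrite det1 /= mulr1 => h.
  have : 0 < a ^+ N.+1 * Re (\det K).
    apply: lt_le_trans h; rewrite exprn_gt0 //.
    by have /andP[] := fpos _ feasible1; lra.
  by rewrite pmulr_rgt0 // exprn_gt0 //; lra.
have uK : K \in unitmx.
  rewrite unitmxE unitfE; apply: contraTneq det_pos => ->.
  by rewrite ltxx.
have pK : psdmx K by case: fK.
have hK' : (invmx K)^t* = invmx K by rewrite (hadj_inv uK) (psdmx_herm pK).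
pose W := (N.+1%:R : R)%:C *: G + a%:C *: invmx K.
have hW : W^t* = W by rewrite hadjD !hadjZ hG hK'.
have bW := herm_block_diagonal hW.
(* Stationarity says that [W], which is [N.+1] times the [D] below, is orthogonal to every off-block
   Hermitian direction. *)
have {}bW i j : blk i != blk j -> W i j = 0.
  apply: bW => H hH bH; rewrite mulmxDl -!scalemxAl linearD !linearZ /= cReD !cReZ.
  apply: (barrier_stationary fK uK Kmax _ hH bH).
  by rewrite gt_eqF //; exact: lt_le_trans ltr01 a1.
pose D := (N.+1%:R^-1 : R)%:C *: W.
have N0 : (N.+1%:R : R) != 0 by rewrite pnatr_eq0.
have DE : D = G + (N.+1%:R^-1 * a)%:C *: invmx K by exact: scale_cancel.
(* [D] is block diagonal, so only the diagonal blocks of [K] enter, and these are identities. *)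
have Dtr : \tr D = \tr (D *m K).
  apply: eq_bigr => i _; rewrite [in RHS]mxE (bigD1 i) //= [X in _ * X](_ : _ = 1); last first.
    by case: fK => _ ->; rewrite ?eqxx.
  rewrite mulr1 big1 ?addr0 // => j ji.
  case: (eqVneq (blk j) (blk i)) => [bji|bji].
    by case: fK => _ ->; rewrite ?(negPf ji) ?mulr0.
  by rewrite /D mxE bW ?mulr0 ?mul0r // eq_sym.
exists K, D; split; first exact: fK.
- by move=> i j ij; rewrite /D mxE bW // mulr0.
- rewrite DE addrC addKr; apply: psdmxZ; last exact: psdmx_inv.
  by rewrite mulr_ge0 ?invr_ge0 //; lra.
rewrite Dtr DE mulmxDl -scalemxAl (mulVmx uK) linearD linearZ /= cReD cReZ.
rewrite mxtrace1 lerD2l; have -> : Re (n%:R : C) = n%:R.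
  by rewrite -(rmorph_nat (real_complex R)).
rewrite -mulrA ler_pdivrMl ?ltr0n //.
apply: (@le_trans _ _ ((2 * g + 1) * n%:R)); first by rewrite ler_wpM2r.
by rewrite -ler_pdivrMr // ltW.
Qed.

End Barrier.

(** * Perturbation identities and regularization of singular factors *)

Lemma mxtrace_mul_cycle (F : comNzRingType) n (A B C D : 'M[F]_n) :
  \tr (A *m (B *m C *m D)) = \tr (D *m A *m B *m C).
Proof. by rewrite mulmxA mxtrace_mulC !mulmxA. Qed.

Lemma mulmx_perturb (F : comNzRingType) n (J q' n' q p : 'M[F]_n) (s : F) :
  (q' + s *: n') *m J *m (q + s *: p) =
  q' *m J *m q + s *: (q' *m J *m p + n' *m J *m q) + (s * s) *: (n' *m J *m p).
Proof.
rewrite mulmxDl mulmxDr !mulmxDl -!scalemxAl -!scalemxAr scalerA.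
by rewrite scalerDr [s *: _ + s *: _]addrC !addrA.
Qed.

Lemma mulmx_perturb_orth (F : comNzRingType) n (q p q' p' : 'M[F]_n) (s : F) :
  q *m p' = 0 -> p *m q' = 0 ->
  (q + s *: p) *m (q' + s *: p') = q *m q' + (s * s) *: (p *m p').
Proof.
move=> qp pq; rewrite mulmxDl !mulmxDr -!scalemxAl -!scalemxAr qp pq.
by rewrite !scaler0 addr0 add0r scalerA.
Qed.

Section Regularization.
Variable R : realType.
Local Notation C := R[i].

Lemma mulmx_adj_eq0 m n (X : 'M[C]_(m, n)) : X *m X^t* = 0 -> X = 0.
Proof.
move=> XX; apply/matrixP => i j.
have /matrixP/(_ i i) := XX; rewrite !mxE => /eqP.
under eq_bigr do rewrite hadj_mxE -normCK.
rewrite psumr_eq0 => [/allP/(_ j (mem_index_enum _))|k _].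
  by rewrite /= sqrf_eq0 normr_eq0 => /eqP.
by rewrite exprn_ge0.
Qed.

Lemma psdmx_mul_adj m n (X : 'M[C]_(m, n)) : psdmx (X *m X^t*).
Proof.
have := psdmx_congr (X^t*) (@psdmx1 R n).
by rewrite trmxCK mulmx1.
Qed.

Lemma adj_pid_mx m n k : (pid_mx k : 'M[C]_(m, n))^t* = pid_mx k.
Proof. by rewrite tr_pid_mx map_pid_mx. Qed.

(* With [Q = L P U] the rank factorisation, [L] and [U] invertible and [P] a
   diagonal projection, take [N = L (1 - P) U^-*]. *)
Lemma orthogonal_regularization n (Q : 'M[C]_n) : exists N : 'M[C]_n,
  Q *m N^t* = 0 /\ forall t : C, t != 0 -> Q + t *: N \in unitmx.
Proof.
have [L [U [k [uL uU kk QE]]]] : exists (L U : 'M[C]_n) (k : nat),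
    [/\ L \in unitmx, U \in unitmx, (k <= n)%N & Q = L *m pid_mx k *m U].
  exists (col_ebase Q), (row_ebase Q), (\rank Q).
  by rewrite col_ebase_unit row_ebase_unit rank_leq_col mulmx_ebase.
have uU' : U^t* \in unitmx by rewrite map_unitmx unitmx_tr.
have cpid : copid_mx k *m pid_mx k = 0 :> 'M[C]_n by apply: mul_copid_mx_pid.
have pidc : pid_mx k *m copid_mx k = 0 :> 'M[C]_n by apply: mul_pid_mx_copid.
have pp : (pid_mx k : 'M[C]_n) *m (pid_mx k : 'M[C]_n) = pid_mx k.
  exact: pid_mx_id.
pose N := L *m copid_mx k *m invmx (U^t*).
have adjc : (copid_mx k : 'M[C]_n)^t* = copid_mx k.
  by rewrite /copid_mx hadjB hadj1 adj_pid_mx.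
exists N; split.
  rewrite /N !hadjM adjc. rewrite hadj_inv // trmxCK QE !mulmxA.
  by rewrite mulmxK // -(mulmxA L) pidc mulmx0 mul0mx.
move=> t t0.
(* [Q + t N = L B U^-*], so it remains to see that [B] has trivial kernel. *)
pose B : 'M[C]_n := pid_mx k *m (U *m U^t*) + t *: copid_mx k.
have -> : Q + t *: N = L *m B *m invmx (U^t*).
  rewrite /B mulmxDr mulmxDl !mulmxA mulmxK // -QE; congr (_ + _).
  by rewrite /N -scalemxAr -scalemxAl.
rewrite !unitmx_mul uL unitmx_inv uU' andbT /= -row_free_unit -kermx_eq0.
(* With [P = pid_mx k], multiplying [W B = 0] on the right by [P W^*] shows that [W P U] times its
   adjoint vanishes. Hence [W P = 0], and [W B] reduces to [t W]. *)
apply/eqP; move: (kermx B) (mulmx_ker B) => W WB.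
have u0 : W *m (pid_mx k : 'M[C]_n) = 0.
  have : W *m (pid_mx k : 'M[C]_n) *m U = 0.
    apply: mulmx_adj_eq0; rewrite !hadjM adj_pid_mx.
    have e1 : (copid_mx k : 'M[C]_n) *m ((pid_mx k : 'M[C]_n) *m W^t*) = 0.
      by rewrite mulmxA cpid mul0mx.
    have e2 : B *m ((pid_mx k : 'M[C]_n) *m W^t*) =
        pid_mx k *m (U *m U^t*) *m ((pid_mx k : 'M[C]_n) *m W^t*).
      by rewrite /B mulmxDl -scalemxAl e1 scaler0 addr0.
    have : W *m B *m ((pid_mx k : 'M[C]_n) *m W^t*) = 0 by rewrite WB mul0mx.
    by rewrite -mulmxA e2 !mulmxA.
  by move/(congr1 (mulmx^~ (invmx U))); rewrite mulmxK // mul0mx.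
move: WB; rewrite /B mulmxDr !mulmxA u0 !mul0mx add0r -scalemxAr /copid_mx.
rewrite mulmxBr mulmx1 u0 subr0 => /eqP; rewrite scaler_eq0 (negPf t0) /=.
by move/eqP.
Qed.

End Regularization.

(** * Block matrices *)

Section Blocks.
Variables (R : realType) (r d : nat).
Local Notation C := R[i].
Local Notation idx := (@mxtens_index r d).

Definition blk_index (x : 'I_(r * d)) : 'I_r := (mxtens_unindex x).1.

Lemma blk_index_mxtens i a : blk_index (idx (i, a)) = i.
Proof. by rewrite /blk_index mxtens_indexK. Qed.

Lemma mxtens_index_eq i a j b : (idx (i, a) == idx (j, b)) = (i == j) && (a == b).
Proof. by rewrite (can_eq (@mxtens_indexK r d)) xpair_eqE. Qed.

Lemma sum_mxtens_index (V : nmodType) (F : 'I_(r * d) -> V) :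
  \sum_x F x = \sum_i \sum_a F (idx (i, a)).
Proof.
rewrite pair_big /=; apply: reindex => /=.
exists (@mxtens_unindex r d) => [[i a] _|x _] /=; first exact: mxtens_indexK.
exact: mxtens_unindexK.
Qed.

Definition mxblk (X : 'M[C]_(r * d)) i j : 'M[C]_d :=
  \matrix_(a, b) X (idx (i, a)) (idx (j, b)).

Lemma mxblkP (X Z : 'M[C]_(r * d)) : (forall i j, mxblk X i j = mxblk Z i j) -> X = Z.
Proof.
move=> h; apply/matrixP => x y.
case: (mxtens_indexP x) => i a; case: (mxtens_indexP y) => j b.
by have /matrixP/(_ a b) := h i j; rewrite !mxE.
Qed.

(** [bdiag] and [boffdiag] are spelled as in the two programs, so the constraints fold to them by
    conversion; computation then goes through [mxblk]. *)
Definition bdiag (A : 'I_r -> 'M[C]_d) : 'M[C]_(r * d) :=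
  \sum_(i < r) (delta_mx i i *t A i).

Definition boffdiag (A : 'I_r -> 'I_r -> 'M[C]_d) : 'M[C]_(r * d) :=
  \sum_(i < r) \sum_(j < r | i != j) (delta_mx i j *t A i j).

Lemma mxblk_sum (I : Type) (s : seq I) (P : pred I) (F : I -> 'M[C]_(r * d)) i j :
  mxblk (\sum_(k <- s | P k) F k) i j = \sum_(k <- s | P k) mxblk (F k) i j.
Proof. by apply/matrixP => a b; rewrite mxE !summxE; apply: eq_bigr => k _; rewrite mxE. Qed.

Lemma mxblk_delta k l (A : 'M[C]_d) i j :
  mxblk (delta_mx k l *t A) i j = if (i == k) && (j == l) then A else 0.
Proof.
apply/matrixP => a b; rewrite mxE tensmxE mxE.
by case: ifP; rewrite ?mul1r ?mul0r ?mxE.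
Qed.

Lemma mxblk_bdiag A i j : mxblk (bdiag A) i j = if i == j then A i else 0.
Proof.
rewrite mxblk_sum (bigD1 i) //= mxblk_delta eqxx /= big1 => [|k ki].
  by rewrite addr0 eq_sym.
by rewrite mxblk_delta eq_sym (negPf ki).
Qed.

Lemma mxblk_boffdiag A i j : mxblk (boffdiag A) i j = if i == j then 0 else A i j.
Proof.
rewrite mxblk_sum (bigD1 i) //= [X in _ + X]big1 => [|k ki].
  rewrite addr0 mxblk_sum; case: eqVneq => [->|ij].
    by rewrite big1 // => l il; rewrite mxblk_delta (negPf il) andbF.
  rewrite (bigD1 j) //= mxblk_delta !eqxx big1 ?addr0 // => l /andP[_ lj].
  by rewrite mxblk_delta eqxx [j == l]eq_sym (negPf lj).
rewrite mxblk_sum big1 // => l _.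
by rewrite mxblk_delta [i == k]eq_sym (negPf ki).
Qed.

Lemma mxblkD X Z i j : mxblk (X + Z) i j = mxblk X i j + mxblk Z i j.
Proof. by apply/matrixP => a b; rewrite !mxE. Qed.

Lemma mxblkN X i j : mxblk (- X) i j = - mxblk X i j.
Proof. by apply/matrixP => a b; rewrite !mxE. Qed.

Lemma mxblkZ t X i j : mxblk (t *: X) i j = t *: mxblk X i j.
Proof. by apply/matrixP => a b; rewrite !mxE. Qed.

Lemma mxblk1 i j : mxblk 1%:M i j = if i == j then 1%:M else 0.
Proof.
apply/matrixP => a b; rewrite !mxE mxtens_index_eq.
by case: eqP => _; rewrite !mxE.
Qed.

Lemma mxblk_adj X i j : mxblk (X^t*) i j = (mxblk X j i)^t*.
Proof. by apply/matrixP => a b; rewrite !mxE. Qed.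

Lemma mxblk_mul X Z i j :
  mxblk (X *m Z) i j = \sum_k mxblk X i k *m mxblk Z k j.
Proof.
apply/matrixP => a b; rewrite mxE mxE sum_mxtens_index summxE.
by apply: eq_bigr => k _; rewrite mxE; apply: eq_bigr => c _; rewrite !mxE.
Qed.

Lemma mxblk_bdiag_mul A X i j : mxblk (bdiag A *m X) i j = A i *m mxblk X i j.
Proof.
rewrite mxblk_mul (bigD1 i) //= mxblk_bdiag eqxx big1 ?addr0 // => k ki.
by rewrite mxblk_bdiag eq_sym (negPf ki) mul0mx.
Qed.

Lemma mxblk_mul_bdiag X A i j : mxblk (X *m bdiag A) i j = mxblk X i j *m A j.
Proof.
rewrite mxblk_mul (bigD1 j) //= mxblk_bdiag eqxx big1 ?addr0 // => k ki.
by rewrite mxblk_bdiag (negPf ki) mulmx0.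
Qed.

Lemma mxtrace_blk X : \tr X = \sum_i \tr (mxblk X i i).
Proof.
rewrite /mxtrace sum_mxtens_index; apply: eq_bigr => i _.
by apply: eq_bigr => a _; rewrite mxE.
Qed.

Lemma bdiag_adj A : (bdiag A)^t* = bdiag (fun i => (A i)^t*).
Proof.
apply: mxblkP => i j; rewrite mxblk_adj !mxblk_bdiag eq_sym.
by case: eqP => [->//|_]; rewrite trmx0 map_mx0.
Qed.

Lemma bdiag_mul A B : bdiag A *m bdiag B = bdiag (fun i => A i *m B i).
Proof.
apply: mxblkP => i j; rewrite mxblk_bdiag_mul !mxblk_bdiag.
by case: eqP => _; rewrite ?mulmx0.
Qed.

Lemma mxtrace_bdiag A : \tr (bdiag A) = \sum_i \tr (A i).
Proof. by rewrite mxtrace_blk; apply: eq_bigr => i _; rewrite mxblk_bdiag eqxx. Qed.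

(** A diagonal block is a compression by the isometry [E] that embeds it. *)
Lemma psdmx_mxblk X i : psdmx X -> psdmx (mxblk X i i).
Proof.
move=> pX; pose E : 'M[C]_(r * d, d) := \matrix_(x, b) (x == idx (i, b))%:R.
have -> : mxblk X i i = E^t* *m X *m E; last exact: psdmx_congr.
apply/matrixP => a b; rewrite mxE [RHS]mxE (bigD1 (idx (i, b))) //= big1 => [|x xb].
  rewrite addr0 !mxE eqxx mulr1 (bigD1 (idx (i, a))) //= big1 => [|x xa].
    by rewrite hadj_mxE mxE eqxx conjC1 mul1r addr0.
  by rewrite hadj_mxE mxE (negPf xa) conjC0 mul0r.
by rewrite [E x b]mxE (negPf xb) mulr0.
Qed.

Lemma block_feasible_blk (K : 'M[C]_(r * d)) : block_feasible blk_index K ->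
  forall i, mxblk K i i = 1%:M.
Proof.
case=> _ h i; apply/matrixP => a b; rewrite !mxE h ?blk_index_mxtens //.
by rewrite mxtens_index_eq eqxx.
Qed.

(** The [Kb i j] can be read off [K] as its blocks, so the existential constrains only the diagonal
    blocks. *)
Lemma kstar_feasibleP (K : 'M[C]_(r * d)) : kstar_feasible K <-> block_feasible blk_index K.
Proof.
have E1 : (1%:M : 'M[C]_r) *t (1%:M : 'M[C]_d) = 1%:M.
  apply: mxblkP => i j; apply/matrixP => a b.
  by rewrite !mxE !mxtens_indexK /= mxtens_index_eq -natrM mulnb.
split=> [[pK [Kb KE]]|fK].
  split=> // x y; case: (mxtens_indexP x) => i a; case: (mxtens_indexP y) => j b.
  rewrite !blk_index_mxtens => <-; move: KE; rewrite E1 -/(boffdiag _) => KE.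
  have /matrixP/(_ a b) : mxblk K i i = mxblk 1%:M i i.
    by rewrite KE mxblkD mxblk_boffdiag eqxx addr0.
  by rewrite !mxE.
split; first by case: fK.
exists (mxblk K); rewrite E1 -/(boffdiag _); apply: mxblkP => i j.
rewrite mxblkD mxblk_boffdiag mxblk1.
by case: eqP => [<-|_]; rewrite ?block_feasible_blk ?addr0 ?add0r.
Qed.

(** The form of [A^T] at [v] is the form of [A] at the conjugate of [v]. *)
Lemma psdmx_tr n (A : 'M[C]_n) : psdmx A -> psdmx A^T.
Proof.
move=> pA; split.
  by apply/hermsymmxE; rewrite -map_trmx psdmx_herm.
move=> v; have [_ /(_ (v^t*)^T)] := pA.
suff -> : (v^t* *m A^T *m v) ord0 ord0 =
   (((v^t*)^T)^t* *m A *m (v^t*)^T) ord0 ord0 by [].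
have -> : ((v^t*)^T)^t* = v^T by apply/matrixP => i j; rewrite !mxE conjCK.
transitivity ((v^t* *m A^T *m v)^T ord0 ord0); first by rewrite [RHS]mxE.
by rewrite !trmx_mul trmxK mulmxA.
Qed.

Lemma block_feasible_tr (K : 'M[C]_(r * d)) : block_feasible blk_index K ->
  block_feasible blk_index K^T.
Proof.
move=> [pK bK]; split; first exact: psdmx_tr.
by move=> x y xy; rewrite mxE bK // eq_sym.
Qed.

End Blocks.

(** * Weak duality *)

Section Duality.
Variables (R : realType) (r d : nat).
Local Notation C := R[i].
Variable Q : 'I_r -> 'M[C]_d.
Local Notation J := (boffdiag (fun _ _ : 'I_r => (1%:M : 'M[C]_d))).

Lemma sdp_feasibleE (Y : 'I_r -> 'M[C]_d) :
  sdp_feasible Y = ((forall i, psdmx (Y i)) /\ psdmx (bdiag Y - J)).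
Proof. by []. Qed.

Lemma boffdiag1_adj : J^t* = J.
Proof.
apply: mxblkP => i j; rewrite mxblk_adj !mxblk_boffdiag eq_sym.
by case: eqP => _; rewrite ?trmx0 ?map_mx0 ?hadj1.
Qed.

(** The off-diagonal part of a block Gram matrix: block [(i, j)] is [Q_i^* Q_j] for distinct indices
    and 0 otherwise. *)
Definition gramoff : 'M[C]_(r * d) := bdiag (fun i => (Q i)^t*) *m J *m bdiag Q.

Lemma sdp_weak_duality (Y : 'I_r -> 'M[C]_d) (K : 'M[C]_(r * d)) :
  sdp_feasible Y -> block_feasible (@blk_index r d) K ->
  Re (\tr (gramoff *m K)) <= Re (\sum_i \tr (Y i *m (Q i *m (Q i)^t*))).
Proof.
rewrite sdp_feasibleE => -[_ pY] fK; have [pK _] := fK.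
have pX : psdmx (bdiag Q *m K *m bdiag (fun i => (Q i)^t*)).
  have E : (bdiag (fun i => (Q i)^t*))^t* = bdiag Q.
    by rewrite -bdiag_adj trmxCK.
  by move: (psdmx_congr (bdiag (fun i => (Q i)^t*)) pK); rewrite E.
(* The [J] part becomes [\tr (gramoff *m K)] by cyclicity; the [Y] part sees only the diagonal
   blocks of [K], which are identities. *)
have := psdmx_tr_mul_ge0 pY pX; rewrite mulmxBl linearB /= => /cRe_ge0.
rewrite cReB subr_ge0; congr (Re _ <= Re _).
  exact: mxtrace_mul_cycle.
rewrite mxtrace_blk; apply: eq_bigr => i _; congr (\tr _).
by rewrite mxblk_bdiag_mul mxblk_mul_bdiag mxblk_bdiag_mul block_feasible_blk // mulmx1.
Qed.

Lemma gramoff_adj : gramoff^t* = gramoff.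
Proof.
rewrite /gramoff !hadjM boffdiag1_adj !bdiag_adj mulmxA.
by congr (_ *m _ *m bdiag _); apply/funext => i; rewrite trmxCK.
Qed.

End Duality.

(** * Strong duality up to an arbitrarily small gap *)

Section StrongDuality.
Variables (R : realType) (r d : nat).
Local Notation C := R[i].
Local Notation J := (boffdiag (fun _ _ : 'I_r => (1%:M : 'M[C]_d))).

(** [gramoff] is quadratic in [t], and feasible [K] have entries of modulus at most 1, so [g] is
    uniform in [K]; [t <= 1] absorbs the quadratic term. *)
Lemma gramoff_perturb (Q N : 'I_r -> 'M[C]_d) : exists2 g : R, 0 <= g &
  forall (t : R) (K : 'M[C]_(r * d)), 0 <= t <= 1 ->
  block_feasible (@blk_index r d) K ->
  Re (\tr (gramoff (fun i => Q i + t%:C *: N i) *m K)) <=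
  Re (\tr (gramoff Q *m K)) + t * g.
Proof.
pose Q' := bdiag (fun i => (Q i)^t*); pose N' := bdiag (fun i => (N i)^t*).
pose X := Q' *m J *m bdiag N + N' *m J *m bdiag Q.
pose Z := N' *m J *m bdiag N.
pose b (W : 'M[C]_(r * d)) := \sum_i \sum_j Re `|W i j|.
have b0 W : 0 <= b W.
  rewrite sumr_ge0 // => i _; rewrite sumr_ge0 // => j _.
  by rewrite cRe_ge0.
have bP W K : block_feasible (@blk_index r d) K -> Re (\tr (W *m K)) <= b W.
  move=> fK; apply: le_trans (ler_norm _) _.
  by apply: tr_mul_Re_bound => i j; apply: feasible_entry_le1 fK.
exists (b X + b Z); first by rewrite addr_ge0.
move=> t K /andP[t0 t1] fK.
have GE : gramoff (fun i => Q i + t%:C *: N i) =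
    gramoff Q + t%:C *: X + (t * t)%:C *: Z.
  have E1 : bdiag (fun i => Q i + t%:C *: N i) = bdiag Q + t%:C *: bdiag N.
    apply: mxblkP => i j; rewrite mxblkD mxblkZ !mxblk_bdiag.
    by case: eqP => _; rewrite ?scaler0 ?addr0.
  have E2 : bdiag (fun i => (Q i + t%:C *: N i)^t*) = Q' + t%:C *: N'.
    by rewrite -(bdiag_adj (fun i => Q i + t%:C *: N i)) E1 hadjD hadjZ !bdiag_adj.
  by rewrite /gramoff E1 E2 mulmx_perturb rmorphM.
rewrite GE 2!mulmxDl -2!scalemxAl 2!mxtraceD 2!mxtraceZ 2!cReD 2!cReZ.
rewrite -addrA lerD2l mulrDr lerD //; first by rewrite ler_wpM2l // bP.
apply: le_trans (_ : t * t * b Z <= _); first by rewrite ler_wpM2l ?mulr_ge0 // bP.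
by rewrite -mulrA ler_wpM2l // ler_piMl.
Qed.

Lemma sdp_strong_duality (Q : 'I_r -> 'M[C]_d) (eps : R) : 0 < eps ->
  exists (Y : 'I_r -> 'M[C]_d) (K : 'M[C]_(r * d)),
    [/\ sdp_feasible Y, block_feasible (@blk_index r d) K &
      Re (\sum_i \tr (Y i *m (Q i *m (Q i)^t*))) <= Re (\tr (gramoff Q *m K)) + eps].
Proof.
move=> eps0.
have /choice[N NP] i := orthogonal_regularization (Q i).
have [g g0 gP] := gramoff_perturb Q N.
(* Half of [eps] pays for the perturbation, half for the barrier gap; [g + eps] keeps the
   denominator positive when [g = 0] and gives [t <= 1]. *)
pose t := eps / (2 * (g + eps)).
have ge0 : 0 < 2 * (g + eps) by lra.
have t0 : 0 < t by rewrite divr_gt0.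
have t1 : t <= 1 by rewrite ler_pdivrMr //; lra.
have tg : t * g <= eps / 2.
  by rewrite /t mulrAC ler_pdivrMr //; nra.
have arith (x y z u : R) : x <= y + eps / 2 -> y <= z + u -> u <= eps / 2 ->
    x <= z + eps by lra.
pose A i := Q i + t%:C *: N i.
have uA i : A i \in unitmx.
  by apply: (NP i).2; rewrite eq_complex /= negb_and (gt_eqF t0).
have [K [D [fK bD pD trD]]] :=
  @barrier_gap R (r * d) _ (@blk_index r d) (gramoff A) (eps / 2)
    (gramoff_adj A) (divr_gt0 eps0 (ltr0n _ 2)).
pose Y i := (invmx (A i))^t* *m mxblk D i i *m invmx (A i).
have DE : D = bdiag (fun i => mxblk D i i).
  apply: mxblkP => i j; rewrite mxblk_bdiag; case: eqVneq => [->//|ij].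
  by apply/matrixP => a b; rewrite !mxE bD // !blk_index_mxtens.
(* Congruence by the inverses of the [A i] turns [gramoff A] back into [J] and [D] into
   [bdiag Y]. *)
have YJ : bdiag Y - J = (bdiag (fun i => invmx (A i)))^t* *m (D - gramoff A)
   *m bdiag (fun i => invmx (A i)).
  apply: mxblkP => i j; rewrite bdiag_adj mxblk_mul_bdiag mxblk_bdiag_mul.
  rewrite !mxblkD !mxblkN mxblk_mul_bdiag mxblk_bdiag_mul mxblk_bdiag mxblk_boffdiag.
  case: eqVneq => [<-|ij]; first by rewrite mulmx0 mul0mx subr0 /Y subr0.
  rewrite {1}DE mxblk_bdiag (negPf ij) !sub0r mulmx1 mulmxN mulNmx.
  rewrite !mulmxA -hadjM mulmxV // hadj1 mul1mx mulmxV //.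
have pY : psdmx (bdiag Y - J) by rewrite YJ; apply: psdmx_congr.
exists Y, K; split; [split|by []|].
- move=> i; have := psdmx_mxblk i pY.
  by rewrite mxblkD mxblkN mxblk_bdiag mxblk_boffdiag eqxx subr0.
- exact: pY.
have pYi i : psdmx (Y i).
  have := psdmx_mxblk i pY.
  by rewrite mxblkD mxblkN mxblk_bdiag mxblk_boffdiag eqxx subr0.
(* Orthogonality of [Q i] and [N i] kills the cross terms; the remainder is positive, so passing
   from [A] back to [Q] can only lower the SDP value. *)
have AA i : A i *m (A i)^t* = Q i *m (Q i)^t* + (t * t)%:C *: (N i *m (N i)^t*).
  have NQ : N i *m (Q i)^t* = 0.
    by rewrite -[N i]trmxCK -hadjM (NP i).1 trmx0 map_mx0.
  have -> : (t * t)%:C = t%:C * t%:C :> C by rewrite rmorphM.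
  rewrite /A hadjD hadjZ; exact: mulmx_perturb_orth (NP i).1 NQ.
apply: (@le_trans _ _ (Re (\tr D))); last first.
  have t01 : 0 <= t <= 1 by rewrite (ltW t0).
  exact: arith trD (gP t K t01 fK) tg.
rewrite DE mxtrace_bdiag !cRe_sum; apply: ler_sum => i _.
have -> : \tr (mxblk D i i) = \tr (Y i *m (A i *m (A i)^t*)).
  rewrite /Y mulmxA -(mulmxA _ (invmx _) (A i)) mulVmx // mulmx1 mxtrace_mulC.
  by rewrite mulmxA -hadjM mulVmx // hadj1 mul1mx.
rewrite AA mulmxDr mxtraceD cReD lerDl -scalemxAr mxtraceZ cReZ.
apply: mulr_ge0; first exact: mulr_ge0 (ltW t0) (ltW t0).
apply: cRe_ge0; exact: psdmx_tr_mul_ge0 (pYi i) (psdmx_mul_adj (N i)).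
Qed.

End StrongDuality.

(** * The two programs *)

Section Purification.
Variables (R : realType) (r d : nat) (phi : 'I_r -> 'cV[R[i]]_(d * d)).
Local Notation C := R[i].
Local Notation J := (boffdiag (fun _ _ : 'I_r => (1%:M : 'M[C]_d))).

(** Columns are indexed by the purifying system, so that multiplying by the adjoint traces it
    out. *)
Definition purif_mx i : 'M[C]_d := \matrix_(a, k) phi i (mxtens_index (k, a)) ord0.

Lemma purif_mx_state (rho : 'I_r -> 'M[C]_d) i :
  is_purification (rho i) (phi i) -> purif_mx i *m (purif_mx i)^t* = rho i.
Proof.
case=> _ <-; apply/matrixP => a b; rewrite !mxE; apply: eq_bigr => k _.
by rewrite !mxE big_ord1 !mxE.
Qed.

Lemma purif_vecE i k a :
  purif_vec phi (mxtens_index (mxtens_index (i, k), a)) ord0 =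
  (sqrtC (r%:R : C))^-1 * purif_mx i a k.
Proof.
rewrite /purif_vec castmxE mxE summxE.
(* Both sides are the same position: [(i d + k) d + a = i (d d) + (k d + a)]. *)
have -> : cast_ord (esym (mulnA r d d)) (mxtens_index (mxtens_index (i, k), a)) =
    mxtens_index (i, mxtens_index (k, a)).
  by apply: val_inj => /=; rewrite mulnDl -mulnA addnA.
have -> : cast_ord (esym (erefl 1%N)) ord0 = mxtens_index (ord0, ord0) :> 'I_(1 * 1).
  exact: val_inj.
rewrite (bigD1 i) //= tensmxE mxE !eqxx mul1r big1 ?addr0 => [|j ji].
  by rewrite mxE.
by rewrite tensmxE mxE eq_sym (negPf ji) mul0r.
Qed.

(** Columns are indexed by the system carrying the states; times its adjoint, this is the marginal
    of [|psi>] on which [K] acts. *)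
Definition purif_fold : 'M[C]_(r * d, d) :=
  \matrix_(x, a) purif_vec phi (mxtens_index (x, a)) ord0.

Lemma purif_vec_expect (K : 'M[C]_(r * d)) :
  ((purif_vec phi)^t* *m (K *t (1%:M : 'M[C]_d)) *m purif_vec phi) ord0 ord0 =
  \tr (K *m (purif_fold *m purif_fold^t*)).
Proof.
rewrite mulmxA mxtrace_mulC mulmxA mxE sum_mxtens_index exchange_big.
apply: eq_bigr => a _; rewrite [RHS]mxE; apply: eq_bigr => y _.
rewrite [purif_fold _ _]mxE; congr (_ * _).
rewrite !mxE sum_mxtens_index; apply: eq_bigr => x _.
rewrite (bigD1 a) //= big1 ?addr0 => [|b ba].
  by rewrite tensmxE !mxE eqxx mulr1.
by rewrite tensmxE !mxE (negPf ba) !mulr0.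
Qed.

(** Up to the factor [1 / r], the marginal at [(j, l)], [(i, k)] is the entry [(k, l)] of
    [Q_i^* Q_j]; this exchange of indices is the source of the transposition. *)
Lemma purif_fold_gram : purif_fold *m purif_fold^t* =
  (r%:R : C)^-1 *: (gramoff purif_mx + bdiag (fun i => (purif_mx i)^t* *m purif_mx i))^T.
Proof.
have sr : (sqrtC (r%:R : C))^-1 * ((sqrtC (r%:R : C))^-1)^*%R = (r%:R)^-1.
  rewrite (conj_Creal (x := (sqrtC (r%:R : C))^-1)); last first.
    by rewrite ger0_real // invr_ge0 sqrtC_ge0 ler0n.
  by rewrite -invfM -expr2 sqrtCK.
apply/matrixP => x y.
case: (mxtens_indexP x) => j l; case: (mxtens_indexP y) => i k.
(* The diagonal terms complete [J] to the block matrix whose blocks are all identities. *)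
have -> : gramoff purif_mx + bdiag (fun i => (purif_mx i)^t* *m purif_mx i) =
   bdiag (fun i => (purif_mx i)^t*) *m (J + 1%:M) *m bdiag purif_mx.
  by rewrite mulmxDr mulmx1 mulmxDl bdiag_mul.
rewrite [RHS]mxE [X in _ = _ * X]mxE.
have -> (M : 'M[C]_(r * d)) : M (mxtens_index (i, k)) (mxtens_index (j, l)) =
   mxblk M i j k l by rewrite mxE.
rewrite mxblk_mul_bdiag mxblk_bdiag_mul mxblkD mxblk_boffdiag mxblk1.
have -> : (if i == j then 0 else 1%:M) + (if i == j then 1%:M else 0) = 1%:M :> 'M[C]_d.
  by case: eqP; rewrite ?add0r ?addr0.
rewrite mulmx1 !mxE big_distrr /=; apply: eq_bigr => a _.
rewrite [purif_fold _ _]mxE hadj_mxE [purif_fold _ _]mxE !purif_vecE hadj_mxE.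
by rewrite rmorphM -sr; ring.
Qed.

End Purification.

(** Reduces equality of the optimal values to weak duality and feasible pairs with arbitrarily small
    gap. *)
Lemma ereal_inf_eq_sup (R : realType) (A B : set R) :
  (forall a b, A a -> B b -> b <= a) ->
  (forall e, 0 < e -> exists a b, [/\ A a, B b & a <= b + e]) ->
  ereal_inf (EFin @` A) = ereal_sup (EFin @` B).
Proof.
move=> BA near; apply/eqP; rewrite eq_le; apply/andP; split; last first.
  apply: ge_ereal_sup => _ [b Bb <-]; apply: le_ereal_inf_tmp => _ [a Aa <-].
  by rewrite lee_fin; exact: BA.
apply/lee_addgt0Pr => e e0; have [a [b [Aa Bb abe]]] := near e e0.
apply: (@le_trans _ _ a%:E); first by apply: ereal_inf_lbound; exists a.
apply: (@le_trans _ _ (b%:E + e%:E)%E); first by rewrite -EFinD lee_fin.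
by apply: leeD2r; apply: ereal_sup_ubound; exists b.
Qed.

Theorem mainTheorem7 (R : realType) (r d : nat) (hr : (2 <= r)%N)
    (rho : 'I_r -> 'M[R[i]]_d) (phi : 'I_r -> 'cV[R[i]]_(d * d))
    (hrho : forall i, is_state (rho i))
    (hphi : forall i, is_purification (rho i) (phi i)) :
  F_SDP rho = F_Kstar phi.
Proof.
have r0 : (0 : R) < r%:R by rewrite ltr0n (leq_trans _ hr).
pose Q := purif_mx phi; pose G := gramoff Q.
have QE i : Q i *m (Q i)^t* = rho i by apply: purif_mx_state.
pose A : set R := [set Re (\sum_i \tr (Y i *m rho i)) | Y in @sdp_feasible R r d].
pose B : set R := [set Re (\tr (G *m K)) | K in block_feasible (@blk_index r d)].
have inf_sup : ereal_inf (EFin @` A) = ereal_sup (EFin @` B).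
  apply: ereal_inf_eq_sup => [_ _ [Y fY <-] [K fK <-]|e e0].
    under eq_bigr do rewrite -QE.
    exact: sdp_weak_duality.
  have [Y [K [fY fK YK]]] := sdp_strong_duality Q e0.
  exists (Re (\sum_i \tr (Y i *m rho i))), (Re (\tr (G *m K))); split.
  - by exists Y.
  - by exists K.
  - by move: YK; under eq_bigr do rewrite QE.
(* The diagonal blocks contribute [\tr (rho i) = 1] each, in total [r / r = 1], which cancels the
   [- 1] of the objective. *)
have objE K : block_feasible (@blk_index r d) K ->
  Re (((purif_vec phi)^t* *m (K *t (1%:M : 'M[R[i]]_d)) *m purif_vec phi) ord0 ord0)
    - 1 = r%:R^-1 * Re (\tr (G *m K^T)).
  move=> fK; rewrite purif_vec_expect purif_fold_gram -/Q -scalemxAr mxtraceZ.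
  rewrite -mxtrace_tr trmx_mul trmxK mulmxDl mxtraceD.
  have -> : \tr (bdiag (fun i => (Q i)^t* *m Q i) *m K^T) = r%:R.
    rewrite mxtrace_blk (eq_bigr (fun=> 1)) ?sumr_const ?card_ord // => i _.
    rewrite mxblk_bdiag_mul (block_feasible_blk (block_feasible_tr fK)) mulmx1.
    by rewrite mxtrace_mulC QE (hrho i).2.
  have -> : (r%:R : R[i])^-1 = (r%:R^-1)%:C by rewrite fmorphV rmorph_nat.
  rewrite cReZ cReD -/G; have -> : Re (r%:R : R[i]) = r%:R.
    by rewrite -(rmorph_nat (real_complex R)).
  by rewrite mulrDr mulVf ?gt_eqF // addrK.
rewrite /F_SDP /F_Kstar.
have -> : [set (Re (\sum_(i < r) \tr (Y i *m rho i)))%:E | Y in @sdp_feasible R r d]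
    = EFin @` A by rewrite /A image_comp.
rewrite inf_sup.
set S := (X in (_ = _ * ereal_sup X)%E).
(* Transposition is an involution of the feasible set, so [K^T] may be replaced by [K]. *)
have -> : S = [set ((r%:R^-1)%:E * x)%E | x in EFin @` B].
  apply/seteqP; split => [_ [K /kstar_feasibleP fK <-]|_ [_ [_ [K fK <-] <-] <-]].
    exists (Re (\tr (G *m K^T)))%:E; last by rewrite objE.
    exists (Re (\tr (G *m K^T))) => //; exists K^T => //.
    exact: block_feasible_tr.
  have fK' := block_feasible_tr fK.
  exists K^T; first exact/kstar_feasibleP.
  by rewrite objE // trmxK.
(* The factor [1 / r] leaves the supremum and joins [1 / (r - 1)] to form the prefactor of
   [F_SDP]. *)
rewrite ereal_sup_pZl ?invr_gt0 // muleA -EFinM; congr (_%:E * _)%E.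
by rewrite invfM mulrC.
Qed.
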